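(* For every $n\ge 0$, Foata's first fundamental transformation $\phi$ maps bijectively the set $\mathcal{I}_n(3\text{-}2\text{-}1)$ of involutions of length $n$ avoiding the classical pattern $3\text{-}2\text{-}1$ onto the set $\mathcal{P}_n$ of faro permutations of length $n$.
   Context: A faro permutation of length $n$ is a permutation $w=w_1\cdots w_n$ of $\{1,\dots,n\}$ obtained by interlacing two increasing words $u,v$ as $u_1v_1u_2v_2\cdots$ with $0\le|u|-|v|\le1$ (equivalently, $w_i<w_{i+2}$ for all $1\le i\le n-2$). A permutation $w$ avoids the classical pattern $3\text{-}2\text{-}1$ if there are no indices $i<j<l$ with $w_i>w_j>w_l$. Foata's transformation $\phi$: write a permutation in standard cycle notation, where each cycle starts with its largest element and the cycles are ordered from left to right in increasing order of their largest elements; cyclically rearrange each cycle so that it ends with its largest element, then reverse each cycle and delete all parentheses; the resulting word, read in one-line notation, is $\phi(w)$. E.g. for $w=7321564$, the standard cycle notation is $(32)(5)(6)(741)$, after rearrangement $(23)(5)(6)(417)$, and $\phi(w)=3256714$. For an involution, $\phi(w)$ is obtained directly by deleting parentheses in the standard cycle notation. *)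

(* Defs.v *)
From mathcomp Require Import all_boot perm.
From mathcomp Require Import classical_sets functions.

Set Implicit Arguments.
Unset Strict Implicit.
Unset Printing Implicit Defensive.

Local Open Scope classical_set_scope.

(** Permutations of {1, ..., n} are elements of ['S_n], i.e. permutations of
    ['I_n] = {0, ..., n-1}: both positions and letters are shifted by one. *)

Definition one_line n (w : 'S_n) : seq 'I_n := [seq w i | i <- enum 'I_n].

Definition increasing n (u : seq 'I_n) : bool :=
  sorted (fun i j : 'I_n => i < j) u.

(** u_1 v_1 u_2 v_2 ...; once one of the words is exhausted, what is left of
    the other one is appended. *)
Fixpoint interlace T (u v : seq T) : seq T :=
  match u, v with
  | x :: u', y :: v' => x :: y :: interlace u' v'
  | _, _ => u ++ v
  end.

Definition faro n (w : 'S_n) : Prop :=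
  exists u v : seq 'I_n,
    [/\ increasing u, increasing v,
        size v <= size u <= (size v).+1
      & one_line w = interlace u v].

Definition avoids321 n (w : 'S_n) : Prop :=
  ~ exists i j l : 'I_n, [/\ i < j, j < l, w j < w i & w l < w j].

Definition involutions321 n : set 'S_n :=
  [set w : 'S_n | involutive w /\ avoids321 w].

Definition faro_perms n : set 'S_n := [set w : 'S_n | faro w].

Definition cycle_max n (w : 'S_n) (m : 'I_n) : bool :=
  all (fun i : 'I_n => i <= m) (orbit w m).

(** [orbit w m] is the word m, w m, w (w m), ...; [enum 'I_n] lists the
    letters in increasing order, so the cycles come in increasing order of
    their largest elements. *)
Definition standard_cycles n (w : 'S_n) : seq (seq 'I_n) :=
  [seq orbit w m | m <- enum 'I_n & cycle_max w m].

(** [rot 1] moves the leading (largest) letter of a cycle to its end. *)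
Definition foata_word n (w : 'S_n) : seq 'I_n :=
  flatten [seq rev (rot 1 c) | c <- standard_cycles w].

Lemma cycle_max_exists n (w : 'S_n) (x : 'I_n) :
  exists2 m, cycle_max w m & x \in orbit w m.
Proof.
have [m xm mmax] :=
  @arg_maxnP _ x (fun i => i \in orbit w x) (@nat_of_ord n) (in_orbit _ _).
have winj : injective w by apply: perm_inj.
have mx : fconnect w m x.
  by rewrite (fconnect_sym winj) fconnect_orbit.
exists m; last by rewrite -fconnect_orbit.
apply/allP => i; rewrite -fconnect_orbit => mi.
apply: mmax; rewrite -fconnect_orbit.
by apply: connect_trans mi; rewrite (fconnect_sym winj).
Qed.

Lemma foata_word_uniq n (w : 'S_n) : uniq (foata_word w).
Proof.
have winj : injective w by apply: perm_inj.
rewrite /foata_word /standard_cycles -map_comp.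
set s := filter _ _; set g := (_ \o _).
have -> : flatten [seq g m | m <- s] = [seq x | m <- s, x <- g m].
  by congr flatten; apply: eq_map => m; rewrite map_id.
apply: allpairs_uniq_dep.
- by rewrite filter_uniq // enum_uniq.
- by move=> m _; rewrite /g /= rev_uniq rot_uniq orbit_uniq.
move=> _ _ /allpairsPdep[m [x [ms xm ->]]] /allpairsPdep[m' [x' [ms' xm' ->]]].
move=> /= xx'; subst x'.
move: ms ms' xm xm'; rewrite /g /= !mem_rev !mem_rot !mem_filter.
move=> /andP[/allP mP _] /andP[/allP mP' _].
rewrite -!fconnect_orbit => mx m'x.
have mm' : fconnect w m m'.
  by apply: connect_trans mx _; rewrite (fconnect_sym winj).
suff -> : m = m' by [].
apply/val_inj/eqP; rewrite /= eqn_leq; apply/andP; split.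
  by apply: mP'; rewrite -fconnect_orbit (fconnect_sym winj).
by apply: mP; rewrite -fconnect_orbit.
Qed.

Lemma mem_foata_word n (w : 'S_n) (x : 'I_n) : x \in foata_word w.
Proof.
have [m mmax xm] := cycle_max_exists w x.
apply/flattenP; exists (rev (rot 1 (orbit w m))).
  by apply/map_f/map_f; rewrite mem_filter mmax mem_enum.
by rewrite mem_rev mem_rot.
Qed.

Lemma size_foata_word n (w : 'S_n) : size (foata_word w) == n.
Proof.
rewrite -[X in _ == X](card_ord n) cardT; apply/eqP/perm_size.
apply: uniq_perm; rewrite ?foata_word_uniq ?enum_uniq // => x.
by rewrite mem_foata_word mem_enum.
Qed.

Definition foata_fun n (w : 'S_n) (i : 'I_n) : 'I_n :=
  tnth (Tuple (size_foata_word w)) i.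

Lemma foata_fun_inj n (w : 'S_n) : injective (foata_fun w).
Proof. by apply/tuple_uniqP; apply: foata_word_uniq. Qed.

Definition foata n (w : 'S_n) : 'S_n := perm (@foata_fun_inj n w).

Lemma one_line_foata n (w : 'S_n) : one_line (foata w) = foata_word w.
Proof.
rewrite /one_line (eq_map (permE (@foata_fun_inj n w))) /foata_fun.
by rewrite map_tnth_enum.
Qed.

(* Main.v *)
Require Import Defs.
From mathcomp Require Import all_boot perm.
From mathcomp Require Import classical_sets functions.

Set Implicit Arguments.
Unset Strict Implicit.
Unset Printing Implicit Defensive.

(** For an involution w, call a letter m a top when w m <= m, that is, when m
    is the largest letter of its cycle.  The word phi(w) lists the tops in
    increasing order, each one followed by its partner w m when w m < m
    ([foata_word_involution]).

    The bridge between the two sets is the condition that w be increasing on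
    its tops.  On the word side it is exactly w_i < w_{i+2}
    ([skip_increasing_cycle_words]): two entries at distance two are either the
    smallest letters of consecutive cycles, or a letter of one cycle and the top
    of a later one, which is automatically larger.  On the pattern side it is
    exactly 3-2-1-avoidance ([avoids321_involutionP]): two tops in the wrong
    order produce a 3-2-1 together with their partners, and conversely the
    middle letter of a 3-2-1 and one of the outer two yield two tops on which w
    decreases.  Hence, for an involution w, phi(w) is faro if and only if w
    avoids 3-2-1 ([faro_foataP]).

    It remains to see that phi is injective on all involutions and that every
    faro word is phi of an involution.  Since tops increase, a cycle of length
    two shows in the word as a descent, and every descent is one, so the word
    determines its cutting into cycles ([cycle_words_inj]).  Conversely, in a
    word with w_i < w_{i+2} no two descents are adjacent; cutting it into its
    descents and its remaining single letters gives cycles whose first letters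
    increase ([skip_increasing_cycle_wordsP]). *)

(** * Faro words *)

Section SkipIncreasing.

Variable n : nat.
Implicit Types (u v s : seq 'I_n).

Fixpoint skip_increasing s : bool :=
  if s is x :: t then
    (if t is _ :: z :: _ then x < z else true) && skip_increasing t
  else true.

(** Peeling off the first letter exchanges the roles of the two words; this
    lets a single induction handle both of them. *)
Lemma interlace_cons (x : 'I_n) u v :
  size v <= (size u).+1 <= (size v).+1 ->
  interlace (x :: u) v = x :: interlace v u.
Proof.
elim: u x v => [|x' u IHu] x [|y v] //=.
  by case: v => [|].
by rewrite !ltnS => uv; congr [:: x, y & _]; apply: IHu.
Qed.

Lemma interlace_skip_increasingP s :
  (exists u v, [/\ increasing u, increasing v,
                   size v <= size u <= (size v).+1 & s = interlace u v])
  <-> skip_increasing s.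
Proof.
split.
  move=> [u [v [uinc vinc szuv ->]]] {s}.
  have [k] := ubnP (size u + size v).
  elim: k u v uinc vinc szuv => // k IHk [|x u] v uinc vinc szuv.
    by case: v vinc szuv.
  rewrite interlace_cons //= addSn ltnS => lek.
  apply/andP; split.
    case: v u uinc {vinc lek} szuv => [|y v] [|x' u] //=.
      by case: v.
    by case/andP.
  apply: IHk => //; last by rewrite addnC.
    exact: path_sorted uinc.
  by move: szuv => /= /andP[-> /=]; rewrite ltnS => ->.
elim: s => [|x t IHt] /=; first by exists [::], [::].
case/andP=> xt /IHt[v [u [vinc uinc szvu def_t]]].
have szuv : size v <= (size u).+1 <= (size v).+1.
  by case/andP: szvu => uv vu; rewrite vu ltnS.
exists (x :: u), v; split=> //; last by rewrite interlace_cons // def_t.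
case: u v uinc def_t szvu {vinc szuv} xt => [|x' u] [|y v] //= uinc -> _ xx'.
by rewrite /increasing /= xx'.
Qed.

(** * Words read off from the cycles of an involution *)

Implicit Types (f g : 'I_n -> 'I_n) (m : 'I_n) (ms : seq 'I_n).

(** The cycle of [m] under an involution [f], written with [m] first. *)
Definition cycle_word f m : seq 'I_n :=
  m :: if f m == m then [::] else [:: f m].

Definition cycle_words f ms : seq 'I_n := flatten [seq cycle_word f m | m <- ms].

Lemma cycle_words_cons f m ms :
  cycle_words f (m :: ms) = cycle_word f m ++ cycle_words f ms.
Proof. by []. Qed.

Lemma eq_in_cycle_words f g ms :
  {in ms, f =1 g} -> cycle_words f ms = cycle_words g ms.
Proof.
by move=> fg; congr flatten; apply/eq_in_map => m /fg; rewrite /cycle_word => ->.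
Qed.

Lemma mem_cycle_words f ms x :
  x \in cycle_words f ms -> exists2 m, m \in ms & x = m \/ x = f m.
Proof.
case/flatten_mapP=> m mms; rewrite inE => /predU1P[->|xm]; first by exists m; auto.
by exists m => //; right; case: ifP xm => // _; rewrite inE => /eqP.
Qed.

Lemma sub_cycle_words f ms : {subset ms <= cycle_words f ms}.
Proof. by move=> m mms; apply/flatten_mapP; exists m; rewrite ?mem_head. Qed.

Lemma ltn_partner f m : f m <= m -> f m != m -> f m < m.
Proof. by move=> le ne; rewrite ltn_neqAle le andbT. Qed.

Lemma increasing_cons_cycle_words f m ms :
    increasing ms -> (if cycle_words f ms is x :: _ then m < x else true) ->
  increasing (m :: ms).
Proof. by case: ms => //= m1 ms; rewrite /increasing /= => -> ->. Qed.

(** Two entries at distance two are either the smallest letters of consecutive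
    cycles, or a letter of one cycle and the first letter of a later cycle; in
    the latter case their order is automatic. *)
Lemma skip_increasing_cycle_words f ms :
  increasing ms -> {in ms, forall m, f m <= m} ->
  skip_increasing (cycle_words f ms) = increasing (map f ms).
Proof.
elim: ms => // m ms IHms minc lef.
have /IHms{}IHms : increasing ms by apply: path_sorted minc.
have {}IHms := IHms (fun x xms => lef x (mem_behead (s := m :: ms) xms)).
case: ms minc lef IHms => [|m' ms] minc lef IHms.
  by rewrite /cycle_words /= /cycle_word; case: eqP.
have lem : f m <= m by rewrite lef ?mem_head.
have lem' : f m' <= m' by rewrite lef ?inE ?eqxx ?orbT.
have /andP[mm' {}minc] := minc.
have fmm' := leq_ltn_trans lem mm'.
rewrite cycle_words_cons.
transitivity ((f m < f m') && increasing (map f (m' :: ms))); last by [].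
rewrite -IHms.
have [t def_t] : exists t, cycle_words f (m' :: ms) = m' :: t.
  by eexists; rewrite cycle_words_cons.
have third : (if t is z :: _ then f m < z else true) = (f m < f m').
  move: def_t; rewrite cycle_words_cons /cycle_word => -[<-].
  case: eqP => [->|_] //=.
  case: ms {lef IHms} minc => [|m'' ms] /=; first by rewrite fmm'.
  by case/andP=> m'm'' _; rewrite fmm' (ltn_trans fmm' m'm'').
rewrite def_t /cycle_word -third; case: eqP => [fm|_] /=.
  by rewrite fm.
by rewrite mm'.
Qed.

Lemma cycle_words_inj f g ms ms' :
    increasing ms -> increasing ms' ->
    {in ms, forall m, f m <= m} -> {in ms', forall m, g m <= m} ->
    cycle_words f ms = cycle_words g ms' ->
  ms = ms' /\ {in ms, f =1 g}.
Proof.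
(* After the first letter, a partner is smaller than it, whereas the next cycle
   starts with a larger letter. *)
have no_partner (h k : 'I_n -> 'I_n) m ms1 s :
    path (fun i j : 'I_n => i < j) m ms1 -> h m <= m -> h m != m ->
  h m :: s <> cycle_words k ms1.
  case: ms1 => //= m1 ms1 /andP[mm1 _] lem ne [hm _].
  by have := ltn_partner lem ne; rewrite hm ltnNge ltnW.
elim: ms ms' => [|m ms IHms] [|m1 ms'] //= minc m1inc lef leg [mm1 eqw].
subst m1.
have lefm := lef _ (mem_head _ _); have legm := leg _ (mem_head _ _).
have [eqfg {}eqw] : f m = g m /\ cycle_words f ms = cycle_words g ms'.
  move: eqw; case: eqP => [fm|/eqP fm]; case: eqP => [gm|/eqP gm] /=.
  - by rewrite fm gm.
  - by move/esym/no_partner; case.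
  - by move/no_partner; case.
  - by case.
have [||x xms|x xms|-> fg] := IHms ms' _ _ _ _ eqw.
- exact: path_sorted minc.
- exact: path_sorted m1inc.
- by rewrite lef // inE xms orbT.
- by rewrite leg // inE xms orbT.
by split=> // x; rewrite inE => /predU1P[->|/fg].
Qed.

(** The involution is built from the right: a descent at the front contributes
    a transposition, any other front letter a fixed point.  That the
    permutation fixes all letters outside of the word is what lets the new
    transposition be composed with it freely. *)
Lemma skip_increasing_cycle_wordsP s :
    uniq s -> skip_increasing s ->
  exists (w : 'S_n) ms, [/\ involutive w, forall x, x \notin s -> w x = x,
    increasing ms, {in ms, forall m, w m <= m} & s = cycle_words w ms].
Proof.
have [k] := ubnP (size s); elim: k s => // k IHk [|a t] /=.
  by move=> _ _ _; exists 1%g, [::]; split=> // x; rewrite !perm1.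
rewrite ltnS => szt /andP[aNt tuniq] /andP[skip_at tskip].
have [[b [s [def_t ltba]]]|no_descent] :
    (exists b s, t = b :: s /\ b < a)
      \/ is_true (if t is b :: _ then a < b else true).
- case: t aNt {szt tuniq skip_at tskip} => [|b s]; first by right.
  rewrite inE negb_or => /andP[ab _].
  by case: (ltngtP a b) => [||/val_inj/eqP]; [right|left; exists b, s|rewrite (negPf ab)].
- subst t.
  move: aNt tuniq skip_at tskip; rewrite inE negb_or => /andP[ab aNs] /=.
  move=> /andP[bNs suniq] skip_a /andP[_ sskip].
  have [|w [ms [wK wfix minc lew def_s]]] := IHk s _ suniq sskip.
    exact: ltn_trans szt.
  have wa : w a = a by apply: wfix.
  have wb : w b = b by apply: wfix.
  pose w' := (w * tperm a b)%g.
  have w'a : w' a = b by rewrite permM wa tpermL.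
  have w'b : w' b = a by rewrite permM wb tpermR.
  have w'E x : x != a -> x != b -> w' x = w x.
    move=> xa xb; rewrite permM tpermD //.
      by rewrite -wa (inj_eq perm_inj) eq_sym.
    by rewrite -wb (inj_eq perm_inj) eq_sym.
  have w'Es : {in s, w' =1 w}.
    by move=> x xs; apply: w'E; apply: contraTneq xs => ->.
  have ms_s x : x \in ms -> x \in s by rewrite def_s; apply: sub_cycle_words.
  exists w', (a :: ms); split.
  + move=> x; have [->|xa] := eqVneq x a; first by rewrite w'a.
    have [->|xb] := eqVneq x b; first by rewrite w'b.
    rewrite (w'E x) // w'E ?wK //.
      by rewrite -wa (inj_eq perm_inj).
    by rewrite -wb (inj_eq perm_inj).
  + move=> x; rewrite !inE !negb_or => /and3P[xa xb xs].
    by rewrite w'E // wfix.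
  + by apply: (@increasing_cons_cycle_words w) => //; rewrite -def_s.
  + move=> x; rewrite inE => /predU1P[->|xms]; first by rewrite w'a ltnW.
    by rewrite w'Es ?ms_s ?lew.
  rewrite cycle_words_cons /cycle_word w'a eq_sym (negPf ab) /=.
  rewrite [in LHS]def_s (@eq_in_cycle_words w' w) // => x /ms_s; exact: w'Es.
have [w [ms [wK wfix minc lew def_t]]] := IHk t szt tuniq tskip.
have wa : w a = a by apply: wfix.
exists w, (a :: ms); split=> //.
- by move=> x; rewrite inE negb_or => /andP[_]; apply: wfix.
- by apply: (@increasing_cons_cycle_words w) => //; rewrite -def_t.
- by move=> x; rewrite inE => /predU1P[->|/lew]; rewrite ?wa.
by rewrite cycle_words_cons /cycle_word wa eqxx /= -def_t.
Qed.

End SkipIncreasing.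

(** * Foata's transformation on involutions *)

Section Involutions.

Variable n : nat.
Implicit Types w : 'S_n.

(** The largest letters of the cycles, when [w] is an involution. *)
Definition tops w : seq 'I_n := [seq m <- enum 'I_n | w m <= m].

Lemma mem_tops w m : (m \in tops w) = (w m <= m).
Proof. by rewrite mem_filter mem_enum andbT. Qed.

Lemma ltn_ord_trans : transitive (fun i j : 'I_n => i < j).
Proof. by move=> j i l; apply: ltn_trans. Qed.

Lemma increasing_tops w : increasing (tops w).
Proof.
apply: sorted_filter; first exact: ltn_ord_trans.
by have := iota_ltn_sorted 0 n; rewrite -val_enum_ord sorted_map.
Qed.

Lemma tops_le w : {in tops w, forall m, w m <= m}.
Proof. by move=> m; rewrite mem_tops. Qed.

Lemma increasing_map_topsP w :
  reflect (forall x z : 'I_n, w x <= x -> w z <= z -> x < z -> w x < w z)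
          (increasing (map w (tops w))).
Proof.
rewrite /increasing sorted_map.
apply: (iffP idP) => [winc x z wx wz xz|winc].
  have rtr : transitive (relpre w (fun i j : 'I_n => i < j)).
    by move=> j i l; apply: ltn_trans.
  rewrite -!mem_tops in wx wz.
  have [ltix|leix] := ltnP (index x (tops w)) (index z (tops w)).
    by apply: (sorted_ltn_index rtr winc).
  have : index z (tops w) < index x (tops w).
    rewrite ltn_neqAle leix andbT; apply: contraTneq xz => /index_inj -> //.
    by rewrite ltnn.
  move/(sorted_ltn_index ltn_ord_trans (increasing_tops w) _ _ wz wx).
  by rewrite ltnNge ltnW.
have := increasing_tops w; rewrite /increasing.
apply: sub_in_sorted (allss _) => x z; rewrite !mem_tops => wx wz; exact: winc.
Qed.

(** If tops x < z have w z < w x, then z, x, w z are the values at the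
    positions w z < w x < z, a 3-2-1.  Conversely, suppose that w i > w j > w l
    with i < j < l.  If w j <= j then w decreases from the top j to the top l;
    otherwise w j < w i are two tops, with images j > i. *)
Lemma avoids321_involutionP w :
  involutive w -> avoids321 w <-> increasing (map w (tops w)).
Proof.
move=> wK; split=> [avw|/increasing_map_topsP winc [i [j [l [ij jl wji wlj]]]]].
  apply/increasing_map_topsP=> x z wx wz xz; rewrite ltnNge; apply/negP => wzx.
  have {}wzx : w z < w x.
    rewrite ltn_neqAle wzx andbT; apply: contraTneq xz => /val_inj/perm_inj ->.
    by rewrite ltnn.
  apply: avw; exists (w z), (w x), z; split; rewrite ?wK //.
    exact: leq_ltn_trans xz.
  exact: leq_trans wx.
have [lewj|ltjw] := leqP (w j) j.
  have lewl : w l <= l by apply/ltnW/(ltn_trans wlj)/(leq_ltn_trans lewj).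
  by have := winc j l lewj lewl jl; rewrite ltnNge ltnW.
have ltiw : i < w i := ltn_trans ij (ltn_trans ltjw wji).
have := winc (w j) (w i); rewrite !wK => /(_ (ltnW ltjw) (ltnW ltiw) wji).
by rewrite ltnNge ltnW.
Qed.

Lemma orbit_involution w m : involutive w -> orbit w m = cycle_word w m.
Proof.
move=> wK; rewrite /cycle_word.
have orbit_m c : fcycle w (m :: c) -> uniq (m :: c) -> orbit w m = m :: c.
  by move=> wc cuniq; rewrite (orbitE wc) ?mem_head //= eqxx rot0.
case: eqP => [wm|/eqP wm]; apply: orbit_m; rewrite //= ?wK ?wm ?eqxx //.
by rewrite inE eq_sym wm.
Qed.

Lemma foata_word_involution w :
  involutive w -> foata_word w = cycle_words w (tops w).
Proof.
move=> wK; rewrite /foata_word /standard_cycles /cycle_words -map_comp.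
have -> : [seq m <- enum 'I_n | cycle_max w m] = tops w.
  apply: eq_filter => m; rewrite /cycle_max orbit_involution // /cycle_word.
  by case: eqP => [->|_]; rewrite /= leqnn ?andbT.
congr flatten; apply: eq_map => m /=.
by rewrite orbit_involution // /cycle_word; case: eqP.
Qed.

Lemma faro_foataP w : involutive w -> faro (foata w) <-> avoids321 w.
Proof.
move=> wK; rewrite avoids321_involutionP // /faro one_line_foata.
rewrite interlace_skip_increasingP foata_word_involution //.
rewrite skip_increasing_cycle_words //; first exact: increasing_tops.
exact: tops_le.
Qed.

Lemma one_line_inj : injective (@one_line n).
Proof.
move=> w w' /eq_in_map eqw; apply/permP => x; apply: eqw; exact: mem_enum.
Qed.

Lemma foata_involution_inj w w' :
  involutive w -> involutive w' -> foata w = foata w' -> w = w'.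
Proof.
move=> wK w'K /(congr1 (@one_line n)).
rewrite !one_line_foata !foata_word_involution // => eqw.
have [eq_tops eqww'] := cycle_words_inj (increasing_tops w) (increasing_tops w')
  (@tops_le w) (@tops_le w') eqw.
(* Every letter is a top or the partner of a top. *)
apply/permP => x; have [wx|xw] := leqP (w x) x.
  by apply: eqww'; rewrite mem_tops.
have wx_top : w x \in tops w by rewrite mem_tops wK ltnW.
by apply: (@perm_inj _ w'); rewrite -eqww' // wK w'K.
Qed.

Lemma uniq_one_line w : uniq (one_line w).
Proof. by rewrite map_inj_uniq ?enum_uniq //; apply: perm_inj. Qed.

Lemma mem_one_line w x : x \in one_line w.
Proof. by rewrite -(permKV w x) map_f ?mem_enum. Qed.

Lemma faro_foata_preimage (p : 'S_n) :
  faro p -> exists2 w : 'S_n, involutive w & foata w = p.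
Proof.
move/interlace_skip_increasingP/(skip_increasing_cycle_wordsP (uniq_one_line p)).
move=> [w [ms [wK _ minc lew def_p]]]; exists w => //.
apply: one_line_inj; rewrite one_line_foata foata_word_involution // def_p.
congr cycle_words; apply: (irr_sorted_eq ltn_ord_trans) => //.
- by move=> x /=; rewrite ltnn.
- exact: increasing_tops.
move=> x; rewrite mem_tops; apply/idP/idP => [wx|/lew //].
have := mem_one_line p x; rewrite def_p => /mem_cycle_words[m mms [->//|def_x]].
(* x is both a top and the partner of the top m, so x = m. *)
suff -> : x = m by [].
apply/val_inj/eqP; rewrite /= eqn_leq; apply/andP; split.
  by rewrite def_x lew.
by have := wx; rewrite {1}def_x wK.
Qed.

End Involutions.

Theorem theorem4p1 (n : nat) :
  set_bij (@involutions321 n) (@faro_perms n) (@foata n).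
Proof.
split.
- by move=> w [wK avw]; apply/faro_foataP.
- move=> w w' /set_mem[wK _] /set_mem[w'K _]; exact: foata_involution_inj.
move=> p farop; have [w wK def_p] := faro_foata_preimage farop.
by exists w => //; split=> //; apply/faro_foataP => //; rewrite def_p.
Qed.
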